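(* For every ordinal $1\leq\alpha<\omega_1$ there exists an immeasurable set $B\subset\mathbb{R}$ of exact Borel class $\Pi_\alpha^0$. For an ordinal $1\leq\alpha<\omega_1$, there exists an immeasurable set of exact Borel class $\Sigma_\alpha^0$ if and only if $2\leq\alpha$; likewise, there exists an immeasurable set of exact Borel class $\Delta_\alpha^0$ if and only if $2\leq\alpha$.
   Context: For $1\leq\alpha<\omega_1$, $\Sigma_\alpha^0$, $\Pi_\alpha^0$ and $\Delta_\alpha^0$ denote the additive, multiplicative and ambiguous Borel classes of subsets of $\mathbb{R}$ ($\Sigma^0_1$ = open, $\Pi^0_1$ = closed, $\Delta_\alpha^0=\Sigma_\alpha^0\cap\Pi_\alpha^0$). A Borel set $B$ is of exact class $\Sigma_\alpha^0$ if $B\in\Sigma_\alpha^0\setminus\Pi_\alpha^0$, of exact class $\Pi_\alpha^0$ if $B\in\Pi_\alpha^0\setminus\Sigma_\alpha^0$, and of exact class $\Delta_\alpha^0$ if $B\in\Delta_\alpha^0$ but $B\notin\Sigma_\beta^0\cup\Pi_\beta^0$ for every $\beta<\alpha$. A Borel measure on $\mathbb{R}$ is a (countably additive, $[0,\infty]$-valued) measure $\mu$ defined on a $\sigma$-algebra $\mathcal{S}$ of subsets of $\mathbb{R}$ containing all Borel sets ($\mathcal S$ may be larger than the Borel $\sigma$-algebra, and $\mu$ is not assumed to be $\sigma$-finite on $\mathbb{R}$). It is translation invariant if $S+t\in\mathcal{S}$ and $\mu(S+t)=\mu(S)$ for all $S\in\mathcal{S}$, $t\in\mathbb{R}$. A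 Borel set $B$ is $\sigma$-finite for $\mu$ if it is a countable union of sets in $\mathcal{S}$ of finite $\mu$-measure. A nonempty Borel set $B\subset\mathbb{R}$ is called immeasurable if for every translation invariant Borel measure $\mu$ on $\mathbb{R}$, either $\mu(B)=0$ or $B$ is not $\sigma$-finite for $\mu$. *)

(* Defs.v *)
From HB Require Import structures.
From mathcomp Require Import all_boot all_order all_algebra.
From mathcomp Require Import all_classical all_reals all_analysis.
From mathcomp Require wochoice.
Import Order.TTheory GRing.Theory Num.Theory.
Import numFieldNormedType.Exports.

Set Implicit Arguments.
Unset Strict Implicit.
Unset Printing Implicit Defensive.

Local Open Scope order_scope.
Local Open Scope classical_set_scope.

(* omega_1 is realized inside an arbitrary well-ordering of the (uncountable)
   powerset of nat, as the set of points with a countable initial segment.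
   Lemmas omega1_well_founded, omega1_countable_segment and omega1_uncountable
   say that its order type is omega_1. *)
Definition powerset_nat := {classic (set nat)}.

Definition powerset_nat_le : rel powerset_nat :=
  sval (wochoice.well_ordering_principle powerset_nat).

Definition omega1 :=
  {x : powerset_nat | `[< countable [set y | powerset_nat_le y x] >]}.

HB.instance Definition _ := Choice.on omega1.

Section powerset_nat_le_theory.
Local Notation "x <<= y" := (powerset_nat_le x y) (at level 70).

Let wo : wochoice.well_order powerset_nat_le.
Proof. exact: (svalP (wochoice.well_ordering_principle powerset_nat)). Qed.

Let wo_chain : wochoice.wo_chain powerset_nat_le predT.
Proof. by move=> A _; exact: wo. Qed.

Lemma powerset_nat_le_refl : reflexive powerset_nat_le.
Proof. by move=> x; exact: (wochoice.wo_chain_reflexive wo_chain). Qed.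

Lemma powerset_nat_le_anti : antisymmetric powerset_nat_le.
Proof. by move=> x y; exact: (wochoice.wo_chain_antisymmetric wo_chain). Qed.

Lemma powerset_nat_le_total : total powerset_nat_le.
Proof. by move=> x y; exact: (wochoice.wo_chainW wo_chain). Qed.

Lemma powerset_nat_le_least (A : set powerset_nat) : A !=set0 ->
  exists2 m, A m & forall x, A x -> m <<= x.
Proof.
move=> [a Aa]; pose P : pred powerset_nat := fun x => `[< A x >].
have [|m [[mA mle] _]] := wo (A := P); first by exists a; exact/asboolP.
by exists m; [exact/asboolP | move=> x Ax; apply: mle; exact/asboolP].
Qed.

Lemma powerset_nat_le_trans : transitive powerset_nat_le.
Proof.
move=> y x z xy yz.
have [|m m3 mle] := powerset_nat_le_least (A := [set x; y; z]).
  by exists x; left; left.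
have [mx my mz] : [/\ m <<= x, m <<= y & m <<= z].
  by split; apply: mle; [left; left|left; right|right].
case: m3 => [[|]|] /= em; rewrite -?em //.
- have exy : x = y by apply: powerset_nat_le_anti; rewrite xy -em mx.
  by rewrite exy.
- have eyz : y = z by apply: powerset_nat_le_anti; rewrite yz -em my.
  by rewrite em -eyz.
Qed.

Lemma powerset_nat_uncountable : ~ countable [set: powerset_nat].
Proof.
move=> /countable_injP[f finj].
pose D : powerset_nat := [set n | exists2 A : powerset_nat, f A = n & ~ A n].
have [DD|nDD] := EM ((D : set nat) (f D)); last first.
  by apply: (nDD); exists D.
case: (DD) => A fA nA; have eAD : A = D by apply: finj; rewrite ?inE.
by apply: nA; rewrite eAD.
Qed.

End powerset_nat_le_theory.

Fact omega1_display : Order.disp_t. Proof. exact: Order.Disp tt tt. Qed.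

Definition omega1_le : rel omega1 := fun x y => powerset_nat_le (\val x) (\val y).

Fact omega1_le_refl : reflexive omega1_le.
Proof. by move=> x; exact: powerset_nat_le_refl. Qed.

Fact omega1_le_anti : antisymmetric omega1_le.
Proof. by move=> x y /powerset_nat_le_anti /val_inj. Qed.

Fact omega1_le_trans : transitive omega1_le.
Proof. by move=> y x z; exact: powerset_nat_le_trans. Qed.

Fact omega1_le_total : total omega1_le.
Proof. by move=> x y; exact: powerset_nat_le_total. Qed.

HB.instance Definition _ := Order.Le_isPOrder.Build omega1_display omega1
  omega1_le_refl omega1_le_anti omega1_le_trans.
HB.instance Definition _ :=
  Order.POrder_isTotal.Build omega1_display omega1 omega1_le_total.

Lemma omega1_well_founded (A : set omega1) : A !=set0 ->
  exists2 m, A m & forall x, A x -> m <= x.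
Proof.
move=> [a Aa]; have [|m [x Ax <-] mle] := powerset_nat_le_least (A := \val @` A).
  by exists (\val a), a.
by exists x => // y Ay; apply: mle; exists y.
Qed.

Lemma omega1_countable_segment (a : omega1) : countable [set b | b <= a].
Proof.
have /asboolP ca := valP a.
have vi : {in [set b | b <= a] &, injective (\val : omega1 -> powerset_nat)}.
  by move=> x y _ _; exact: val_inj.
rewrite -(eq_countable (inj_card_eq vi)); apply: sub_countable ca.
by apply: subset_card_le => _ [x xa <-].
Qed.

Lemma omega1_uncountable : ~ countable [set: omega1].
Proof.
move=> c1; pose W := range (\val : omega1 -> powerset_nat).
have cW : countable W by exact: card_le_trans (card_image_le _ _) c1.
have [] : (~` W) !=set0.
  apply: contrapT => /set0P/negP/negPn/eqP W0; apply: powerset_nat_uncountable.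
  by rewrite -(setCK setT) setCT -W0 setCK.
move=> a Wa; have [|m Wm mle] := powerset_nat_le_least (A := ~` W).
  by exists a.
suff mP : `[< countable [set y | powerset_nat_le y m] >].
  by apply: Wm; exists (exist _ m mP).
apply/asboolP.
apply: (@sub_countable _ _ _ (\bigcup_b (if b then W else [set m]))).
  apply: subset_card_le => y /= ym; have [Wy|nWy] := EM (W y).
    by exists true.
  by exists false => //=; apply: powerset_nat_le_anti; rewrite ym mle.
apply: bigcup_countable; first exact: countableP.
by case=> _ //; exact: countable1.
Qed.

Lemma omega1_inhabited : inhabited omega1.
Proof.
apply: contrapT => n1; apply: omega1_uncountable.
by rewrite (_ : [set: _] = set0) // -subset0 => x _; apply: n1; exists.
Qed.

Lemma omega1_bottom_ex : {m : omega1 | forall a, m <= a}.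
Proof.
apply: cid; have [a] := omega1_inhabited.
have [|m _ mle] := omega1_well_founded (A := setT); first by exists a.
by exists m => b; exact: mle.
Qed.

HB.instance Definition _ := Order.hasBottom.Build omega1_display omega1
  (svalP omega1_bottom_ex).

Lemma omega1_succ_ex (a : omega1) :
  {s : omega1 | a < s & forall b, a < b -> s <= b}.
Proof.
apply: cid2; apply: (omega1_well_founded (A := [set b | a < b])).
apply: contrapT => ub; apply: omega1_uncountable.
apply: sub_countable (omega1_countable_segment a); apply: subset_card_le.
by move=> b _ /=; rewrite leNgt; apply/negP => ab; apply: ub; exists b.
Qed.

Definition osucc (a : omega1) : omega1 := s2val (omega1_succ_ex a).

Lemma ltosucc a : a < osucc a.
Proof. exact: (s2valP (omega1_succ_ex a)). Qed.

Lemma osucc_le a b : a < b -> osucc a <= b.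
Proof. exact: (s2valP' (omega1_succ_ex a)). Qed.

Definition oone : omega1 := osucc \bot.
Definition otwo : omega1 := osucc oone.

(* Sigma0 a is indexed by ordinals a >= 1; Sigma0 \bot is empty. *)
Inductive Sigma0 (T : topologicalType) : omega1 -> set (set T) :=
| Sigma0_open (U : set T) : open U -> Sigma0 oone U
| Sigma0_bigcup (a : omega1) (b : nat -> omega1) (F : nat -> set T) :
    (forall n, oone <= b n < a) ->
    (forall n, Sigma0 (b n) (~` F n)) ->
    Sigma0 a (\bigcup_n F n).

Definition Pi0 (T : topologicalType) (a : omega1) : set (set T) :=
  [set A | Sigma0 a (~` A)].

Definition Delta0 (T : topologicalType) (a : omega1) : set (set T) :=
  Sigma0 a `&` Pi0 a.

Definition exact_Sigma0 (T : topologicalType) (a : omega1) : set (set T) :=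
  Sigma0 a `\` Pi0 a.

Definition exact_Pi0 (T : topologicalType) (a : omega1) : set (set T) :=
  Pi0 a `\` Sigma0 a.

Definition exact_Delta0 (T : topologicalType) (a : omega1) : set (set T) :=
  [set B | Delta0 a B /\ forall b, oone <= b -> b < a -> ~ (Sigma0 b `|` Pi0 b) B].

Local Close Scope order_scope.
Local Open Scope ring_scope.

Definition Borel (R : realType) : set (set R) := <<s [set U : set R | open U] >>.

Definition translate (R : realType) (A : set R) (t : R) : set R :=
  [set x + t | x in A].

Definition translation_invariant (R : realType) (S : set (set R))
    (mu : set R -> \bar R) :=
  forall (A : set R) (t : R), S A -> S (translate A t) /\ mu (translate A t) = mu A.

(* For a sigma-algebra S, the measurable sets of g_sigma_algebraType S, which
   form <<s S >>, are exactly the elements of S (sigma_algebra_id). *)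
Definition immeasurable (R : realType) (B : set R) :=
  [/\ Borel B, B !=set0 &
    forall S : set (set R), sigma_algebra setT S -> @Borel R `<=` S ->
    forall mu : {measure set (g_sigma_algebraType S) -> \bar R},
      translation_invariant S mu ->
      mu B = 0%E \/ ~ sigma_finite (B : set (g_sigma_algebraType S)) mu].

(* Main.v *)
Require Import Defs.
From mathcomp Require Import all_boot all_order all_algebra.
From mathcomp Require Import all_classical all_reals all_analysis.
From mathcomp Require Import borel_hierarchy measurable_realfun lra.

(* Split the ternary digit positions into infinite blocks 0, 1, 2, ... Given a
   subset A of the Cantor space, let B be the union over n of the sets B_n + 2n,
   where B_n consists of the sums of 2 y_i / 3^(i+1) over the sequences y that vanish
   outside blocks 0, ..., n and whose restriction to block 0 lies in A.
   Adding digits in block n+1 shows that uncountably many pairwise disjoint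
   translates of B_n + 2n lie in B, so if B is sigma-finite for an invariant measure
   then each B_n + 2n, hence B, is null.
   The union is locally finite, so B is closed when A is; and the sequences living on
   block 0 embed the Cantor space continuously into the line so that B pulls back to A.
   Hence B and A have the same exact class, apart from open A, for which B is only
   F_sigma.
   In the Cantor space exact classes come from diagonalizing universal sets; exact
   Delta classes come from gluing sets of all smaller classes along the cylinders
   0^n 1. Conversely nonempty open sets are measured by Lebesgue measure. *)

Set Implicit Arguments.
Unset Strict Implicit.
Unset Printing Implicit Defensive.

Import Order.TTheory GRing.Theory Num.Theory.
Import numFieldNormedType.Exports.
Local Open Scope order_scope.
Local Open Scope classical_set_scope.

(** * Borel classes *)

Lemma omega1_ind (P : omega1 -> Prop) :
  (forall a, (forall b, b < a -> P b) -> P a) -> forall a, P a.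
Proof.
move=> IH a; apply: contrapT => nPa.
have [|m nPm mle] := omega1_well_founded (A := [set x | ~ P x]); first by exists a.
apply: nPm; apply: IH => b bm; apply: contrapT => /mle.
by rewrite leNgt bm.
Qed.

Lemma otwo_le a : (otwo <= a) = (oone < a).
Proof.
apply/idP/idP => [|/osucc_le //].
by apply: lt_le_trans; exact: ltosucc.
Qed.

(* Interiors are taken because balls of a pseudometric type need not be open. *)
Lemma Fsigma_open_pseudometric (R : realType) (T : pseudoMetricType R)
  (U : set T) : open U -> Fsigma U.
Proof.
move=> oU; pose r n : R := n.+1%:R^-1%R.
have r0 n : (0 < r n)%R by rewrite /r invr_gt0 ltr0n.
exists (fun n => ~` \bigcup_(y in ~` U) interior (ball y (r n))).
  move=> n; apply: open_closedC; apply: bigcup_open => y _; exact: open_interior.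
apply/seteqP; split=> [x Ux|x [n _ nx]]; last first.
  apply: contrapT => nUx; apply: nx; exists x => //.
  by apply: nbhsx_ballx; exact: r0.
have : nbhs x U by exact: open_nbhs_nbhs.
rewrite -nbhs_ballE => -[e /= e0 eU].
have [n ne] : exists n, (r n < e)%R.
  exists (Num.truncn e^-1); rewrite /r invf_plt ?posrE//.
  exact: truncnS_gt.
exists n => // -[y nUy /interior_subset xy]; apply: nUy.
apply: eU; apply: ball_sym; apply: le_ball xy; exact: ltW.
Qed.

Section borel_hierarchy.
Context {T : topologicalType}.
Implicit Types (A B F U : set T) (a b : omega1).

Lemma Sigma0_gt_bot a A : Sigma0 a A -> oone <= a.
Proof. by case=> // {}a b F /(_ 0%N)/andP[b1 /ltW/(le_trans b1)]. Qed.

(** The union constructor cannot yield class [oone]: it would need an index [b n] with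
    [oone <= b n < oone]. *)
Lemma Sigma0_one A : Sigma0 oone A <-> open A.
Proof.
split; last exact: Sigma0_open.
move e1 : oone => o S; case: S e1 => // a b F /(_ 0%N)/andP[b1 ba] _ e.
by move: (le_lt_trans b1 ba); rewrite e ltxx.
Qed.

Lemma Pi0C a A : Pi0 a (~` A) <-> Sigma0 a A.
Proof. by rewrite /Pi0 /= setCK. Qed.

Lemma Pi0_one A : Pi0 oone A <-> closed A.
Proof. by rewrite /Pi0 /= Sigma0_one openC. Qed.

(** This makes the classes increase with the index. It is later supplied for the line, as a
    pseudometric space, and for the Cantor space. *)
Hypothesis FsigmaT : forall U, open U -> Fsigma U.

Lemma Sigma0_gt1P a A : oone < a -> Sigma0 a A <->
  exists (b : nat -> omega1) (F : nat -> set T),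
    [/\ forall n, oone <= b n < a, forall n, Pi0 (b n) (F n) & A = \bigcup_n F n].
Proof.
move=> a1; split=> [S|[b [F [ba bF ->]]]]; last exact: Sigma0_bigcup bF.
case: S a1 => [U /FsigmaT[F cF ->] a1|{}a b F ba bF _]; last by exists b, F.
by rewrite ltxx in a1.
Qed.

Lemma Sigma0_open_ge1 a A : oone <= a -> open A -> Sigma0 a A.
Proof.
rewrite le_eqVlt => /predU1P[<-|a1]; first by move=> /Sigma0_one.
move=> /FsigmaT[F cF ->]; apply/(Sigma0_gt1P _ a1); exists (fun=> oone), F.
split=> [n|n|//]; first by rewrite lexx a1.
by apply/Pi0_one.
Qed.

Lemma Sigma0_le a b A : a <= b -> Sigma0 a A -> Sigma0 b A.
Proof.
move=> ab SA; have a1 := Sigma0_gt_bot SA.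
have [b1|] := ltP oone b; last first.
  move=> b1; have /eqP eb : b == oone by rewrite eq_le b1 (le_trans a1 ab).
  have /eqP <- : a == b by rewrite eq_le ab eb a1.
  exact: SA.
move: a1; rewrite le_eqVlt => /predU1P[e|a1].
  by apply: Sigma0_open_ge1 (ltW b1) _; apply/Sigma0_one; rewrite e.
move: SA => /(Sigma0_gt1P _ a1)[c [F [ca cF ->]]].
apply/(Sigma0_gt1P _ b1); exists c, F; split=> // n.
by have /andP[-> /= /lt_le_trans ->] := ca n.
Qed.

Lemma Pi0_closed_ge1 a A : oone <= a -> closed A -> Pi0 a A.
Proof. by move=> a1 cA; apply: Sigma0_open_ge1 => //; rewrite openC. Qed.

Lemma Pi0_lt_Sigma0 a b A : oone <= b -> b < a -> Pi0 b A -> Sigma0 a A.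
Proof.
move=> b1 ba bA; apply/(Sigma0_gt1P _ (le_lt_trans b1 ba)).
exists (fun=> b), (fun=> A); split=> //; first by rewrite b1 ba.
by rewrite bigcup_const//; exists 0%N.
Qed.

Lemma Sigma0_bigcup_nat a (F : nat -> set T) :
  (forall n, Sigma0 a (F n)) -> Sigma0 a (\bigcup_n F n).
Proof.
move=> SF; have := Sigma0_gt_bot (SF 0%N).
rewrite le_eqVlt => /predU1P[e|a1].
  by rewrite -e; apply/Sigma0_one; apply: bigcup_open => n _;
    apply/Sigma0_one; rewrite e.
have /choice[g gP] : forall n, exists bG : (nat -> omega1) * (nat -> set T),
    [/\ forall m, oone <= bG.1 m < a, forall m, Pi0 (bG.1 m) (bG.2 m) &
        F n = \bigcup_m bG.2 m].
  by move=> n; have /(Sigma0_gt1P _ a1)[b [G ?]] := SF n; exists (b, G).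
(* [f] decodes pairs; a number that codes no pair falls back to [(0, 0)], which merely repeats a
   piece. *)
pose f n : nat * nat := odflt (0, 0)%N (unpickle n).
apply/(Sigma0_gt1P _ a1).
exists (fun n => (g (f n).1).1 (f n).2), (fun n => (g (f n).1).2 (f n).2).
split=> [n|n|]; first by have [] := gP (f n).1.
  by have [] := gP (f n).1.
apply/seteqP; split=> [x [n _]|x [n _]].
  have [_ _ ->] := gP n; move=> -[m _ Gx]; exists (pickle (n, m)) => //.
  by rewrite /f pickleK.
move=> Gx; exists (f n).1 => //; have [_ _ ->] := gP (f n).1.
by exists (f n).2.
Qed.

Lemma Sigma0U a A B : Sigma0 a A -> Sigma0 a B -> Sigma0 a (A `|` B).
Proof.
move=> SA SB; rewrite -bigcup2E; apply: Sigma0_bigcup_nat => -[//|[//|n]] /=.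
by apply: Sigma0_open_ge1 (Sigma0_gt_bot SA) _; exact: open0.
Qed.

Lemma Pi0I a A B : Pi0 a A -> Pi0 a B -> Pi0 a (A `&` B).
Proof. by move=> PA PB; rewrite /Pi0 /= setCI; exact: Sigma0U. Qed.

(** Intersect the union termwise: a closed set is [Pi0 (b n)] for every index [b n]. At level one
    this would fail. *)
Lemma Sigma0I_closed a A F : oone < a -> Sigma0 a A -> closed F ->
  Sigma0 a (A `&` F).
Proof.
move=> a1 /(Sigma0_gt1P _ a1)[b [G [ba PG ->]]] cF; apply/(Sigma0_gt1P _ a1).
exists b, (fun n => G n `&` F); split=> // [n|]; last by rewrite setI_bigcupl.
by apply: Pi0I => //; apply: Pi0_closed_ge1 => //; have /andP[] := ba n.
Qed.

End borel_hierarchy.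

Lemma Sigma0_preimage (X Y : topologicalType) (f : X -> Y) a (A : set Y) :
  continuous f -> Sigma0 a A -> Sigma0 a (f @^-1` A).
Proof.
move=> cf; elim=> {a A} [U oU|a b F ba _ IH].
  by apply: Sigma0_open; move/continuousP: cf; exact.
by rewrite preimage_bigcup; apply: Sigma0_bigcup ba _ => n; exact: IH.
Qed.

Lemma Pi0_preimage (X Y : topologicalType) (f : X -> Y) a (A : set Y) :
  continuous f -> Pi0 a A -> Pi0 a (f @^-1` A).
Proof. by move=> cf; rewrite /Pi0 /= preimage_setC; exact: Sigma0_preimage. Qed.

Lemma Sigma0_Borel (R : realType) a (A : set R) : Sigma0 a A -> Borel A.
Proof.
have [_ BC Bbig] := @smallest_sigma_algebra R setT [set U : set R | open U].
elim=> {a A} [U oU|a b F _ _ IH]; first exact: sub_sigma_algebra.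
apply: Bbig => n; rewrite -(setCK (F n)) -setTD; by apply: BC; exact: IH.
Qed.

(** * Exact classes in the Cantor space *)

Definition cantor_cylinder (s : seq bool) : set cantor_space :=
  [set x | forall i, (i < size s)%N -> x i = nth false s i].

Lemma cantor_coord_continuous (i : nat) :
  continuous ((fun x => x i) : cantor_space -> bool).
Proof. exact: (@proj_continuous nat (fun=> bool) i). Qed.

Lemma cantor_coord_open (i : nat) (A : set bool) :
  open [set x : cantor_space | A (x i)].
Proof.
have /continuousP := @cantor_coord_continuous i.
by apply; exact: discrete_open.
Qed.

Lemma continuous_cantor (T : topologicalType) (f : T -> cantor_space) :
  (forall i, continuous (fun t => f t i : bool)) -> continuous f.
Proof.
move=> cf t; apply/(pointwise_cvgP (f t : nat -> bool)) => i.
exact: cf.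
Qed.

Lemma cantor_cylinder_open s : open (cantor_cylinder s).
Proof.
rewrite (_ : cantor_cylinder s =
  ~` \bigcup_(i in `I_(size s)) [set x : cantor_space | x i <> nth false s i]).
  apply: closed_openC; apply: closed_bigcup => [|i _]; first exact: finite_II.
  exact/open_closedC/(@cantor_coord_open i [set nth false s i]).
apply/seteqP; split=> x; first by move=> sx [i /= si]; apply; exact: sx.
by move=> nx i si; apply: contrapT => xi; apply: nx; exists i.
Qed.

Lemma nbhs_cantor_cylinder (x : cantor_space) n :
  nbhs x (cantor_cylinder (mkseq x n)).
Proof.
apply: open_nbhs_nbhs; split; first exact: cantor_cylinder_open.
by move=> i; rewrite size_mkseq => ?; rewrite nth_mkseq.
Qed.

Lemma cantor_cylinder_closed s : closed (cantor_cylinder s).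
Proof.
rewrite (_ : cantor_cylinder s =
  \bigcap_(i in `I_(size s)) [set x : cantor_space | x i = nth false s i]) //.
apply: closed_bigI => i _; rewrite -openC.
exact: (@cantor_coord_open i (~` [set nth false s i])).
Qed.

(** Otherwise, picking a point outside [U] in each cylinder around [x] gives a sequence converging
    to [x] coordinatewise. *)
Lemma cantor_nbhsP (x : cantor_space) (U : set cantor_space) : nbhs x U ->
  exists n, cantor_cylinder (mkseq x n) `<=` U.
Proof.
move=> xU; apply: contrapT => nU.
have /choice[y yP] : forall n, exists y,
    cantor_cylinder (mkseq x n) y /\ ~ U y.
  move=> n; apply: contrapT => ny; apply: nU; exists n => y xy.
  by apply: contrapT => nUy; apply: ny; exists y.
have yx : y @ \oo --> x.
  apply/(pointwise_cvgP (x : nat -> bool)) => i.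
  have : (fun n => y n i) @ \oo --> x i; last exact.
  apply: cvg_near_cst; near=> n.
  have [+ _] := yP n; move=> /(_ i); rewrite size_mkseq => -> //.
    by rewrite nth_mkseq //; near: n; exact: nbhs_infty_gt.
  by near: n; exact: nbhs_infty_gt.
have /yx[N _ NU] := xU; exact: (yP N).2 (NU N (leqnn _)).
Unshelve. all: by end_near. Qed.

Lemma cantor_open_bigcup (U : set cantor_space) : open U ->
  U = \bigcup_(s in [set s | cantor_cylinder s `<=` U]) cantor_cylinder s.
Proof.
move=> oU; apply/seteqP; split=> [x Ux|x [s sU]]; last exact: sU.
have [|n nU] := @cantor_nbhsP x U; first exact: open_nbhs_nbhs.
exists (mkseq x n) => //; exact: nbhs_singleton (nbhs_cantor_cylinder _ _).
Qed.

(** There are countably many cylinders, and all of them are closed. *)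
Lemma cantor_Fsigma_open (U : set cantor_space) : open U -> Fsigma U.
Proof.
move=> /cantor_open_bigcup UE.
pose F n := if (unpickle n : option (seq bool)) is Some s then
  [set x | cantor_cylinder s x /\ cantor_cylinder s `<=` U] else set0.
exists F => [n|]; rewrite ?/F.
  case: unpickle => [s|]; last exact: closed0.
  have [sU|nsU] := EM (cantor_cylinder s `<=` U).
    rewrite (_ : mkset _ = cantor_cylinder s); first exact: cantor_cylinder_closed.
    by apply/seteqP; split=> x // [].
  rewrite (_ : mkset _ = set0); first exact: closed0.
  by apply/seteqP; split=> x // [_ /nsU].
apply/seteqP; split=> [x|x [n _]]; last first.
  by case: unpickle => // s [sx]; exact.
rewrite {1}UE => -[s sU sx]; exists (pickle s) => //.
by rewrite pickleK.
Qed.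

Lemma omega1_lt_surj a : oone < a -> exists b : nat -> omega1,
  (forall n, oone <= b n < a) /\ forall c, oone <= c < a -> exists n, b n = c.
Proof.
move=> a1; have : countable [set c | oone <= c < a].
  apply: sub_countable (omega1_countable_segment a); apply: subset_card_le.
  by move=> c /= /andP[_ /ltW].
move=> /countable_injP[f finj].
have /choice[b bP] : forall n, exists c, oone <= c < a /\
    forall c', oone <= c' < a -> f c' = n -> c = c'.
  move=> n; have [[c [ca fc]]|nc] := EM (exists c, oone <= c < a /\ f c = n).
    by exists c; split=> // c' ca' fc'; apply: finj; rewrite ?inE// fc.
  (* Numbers outside the range of [f] get the value [oone], which still lies below [a]. *)
  exists oone; rewrite lexx a1; split=> // c ca fc; exfalso; apply: nc.
  by exists c.
exists b; split=> [n|c ca]; first by have [] := bP n.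
by exists (f c); apply: (bP _).2.
Qed.

(* [S] is a universal [Sigma0 a] family: (i) its sections exhaust the class and
   (ii) the instance [g = id] gives the diagonal; arbitrary [g] is only there to
   carry the induction, where codes get replaced by their subsequences. *)
Lemma universal_Sigma0 a : oone <= a ->
  exists S : cantor_space -> set cantor_space,
    (forall A, Sigma0 a A -> exists c, S c = A) /\
    (forall g : cantor_space -> cantor_space, continuous g ->
      Sigma0 a [set x | S (g x) x]).
Proof.
elim/omega1_ind: a => a IH; rewrite le_eqVlt => /predU1P[<-|a1].
  (* At level one, a code marks which cylinders enter the union. *)
  exists (fun c => \bigcup_(s in [set s | c (pickle s)]) cantor_cylinder s).
  split=> [A /Sigma0_one oA|g cg].
    exists (fun n => if unpickle n is Some s then `[< cantor_cylinder s `<=` A >]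
                     else false).
    rewrite [RHS]cantor_open_bigcup//; congr bigcup.
    by apply/funext => s; rewrite /mkset pickleK asboolE.
  apply/Sigma0_one.
  rewrite (_ : mkset _ = \bigcup_s ((fun x => g x (pickle s)) @^-1` [set true] `&`
      cantor_cylinder s)); last first.
    by apply/seteqP; split=> [x [s gs xs]|x [s _ [gs xs]]]; exists s.
  apply: bigcup_open => s _; apply: openI; last exact: cantor_cylinder_open.
  have /continuousP cgP := cg.
  exact: (cgP _ (@cantor_coord_open (pickle s) [set true])).
have [b [ba bsurj]] := omega1_lt_surj a1.
have /choice[S SP] : forall i, exists S : cantor_space -> set cantor_space,
    (forall A, Sigma0 (b i) A -> exists c, S c = A) /\
    (forall g : cantor_space -> cantor_space, continuous g ->
      Sigma0 (b i) [set x | S (g x) x]).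
  by move=> i; have /andP[b1 bia] := ba i; exact: IH.
(* A code splits into slots [m], each standing for a pair (i, j): slot (i, j) may hold a set of
   class [b i], so every smaller class has infinitely many slots. *)
pose d m : nat * nat := odflt (0, 0)%N (unpickle m).
pose part (m : nat) (c : cantor_space) : cantor_space := fun k => c (pickle (m, k)).
exists (fun c => \bigcup_m ~` S (d m).1 (part m c)); split.
  move=> A /(Sigma0_gt1P cantor_Fsigma_open _ a1)[b' [F [b'a PF ->]]].
  (* Slot (i, j) holds the complement of [F j] when [b' j] is the class [b i]; otherwise it holds
     the full set, whose complement adds nothing to the union. *)
  have /choice[c cP] : forall m, exists c : cantor_space,
      ~` S (d m).1 c = if b' (d m).2 == b (d m).1 then F (d m).2 else set0.
    move=> m; case: eqP => [e|_].
      have [+ _] := SP (d m).1; move=> /(_ (~` F (d m).2)).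
      by rewrite -e => /(_ (PF _))[c cE]; exists c; rewrite cE setCK.
    have [+ _] := SP (d m).1; move=> /(_ setT)[|c cE]; last first.
      by exists c; rewrite cE setCT.
    apply: (Sigma0_open_ge1 cantor_Fsigma_open); last exact: openT.
    by have /andP[] := ba (d m).1.
  pose e n : nat * nat := odflt (0, 0)%N (unpickle n).
  exists (fun n => c (e n).1 (e n).2).
  have partE m : part m (fun n => c (e n).1 (e n).2) = c m.
    by apply/funext => k; rewrite /part /e pickleK.
  apply/seteqP; split=> [x [m _]|x [j _ Fx]].
    rewrite partE cP; case: ifP => // _ Fx; by exists (d m).2.
  have [i bi] := bsurj _ (b'a j).
  by exists (pickle (i, j)) => //; rewrite partE cP /d pickleK /= bi eqxx.
move=> g cg; apply/(Sigma0_gt1P cantor_Fsigma_open _ a1).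
exists (fun m => b (d m).1), (fun m => [set x | ~ S (d m).1 (part m (g x)) x]).
split=> // m; apply/Pi0C; apply: (SP (d m).1).2 (fun x => part m (g x)) _.
apply: continuous_cantor => k x.
apply: (@continuous_comp _ _ _ g (fun y : cantor_space => y (pickle (m, k)))).
  exact: cg.
exact: cantor_coord_continuous.
Qed.

(** If the complement of the diagonal set were [Sigma0 a], it would be a section [S c], and [c]
    would belong to it exactly when it does not. *)
Lemma exact_Sigma0_cantor a : oone <= a ->
  exists A : set cantor_space, exact_Sigma0 a A.
Proof.
move=> a1; have [S [Sall Sdiag]] := universal_Sigma0 a1.
exists [set x | S x x]; split; first by apply: (Sdiag id) => x; exact: cvg_id.
move=> /Sall[c Sc].
have : S c c <-> ~ S c c by rewrite {1}Sc.
move=> [h1 h2]; have nScc : ~ S c c by move=> Scc; exact: (h1 Scc Scc).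
exact: nScc (h2 nScc).
Qed.

(** * Gluing countably many sets along disjoint cylinders *)

Section gluing.

(** The cylinders of the words 0^n 1 are pairwise disjoint and omit only the zero sequence. *)
Definition cantor_piece n : set cantor_space :=
  cantor_cylinder (rcons (nseq n false) true).

Definition cantor_embed n (x : cantor_space) : cantor_space :=
  fun i => if (i < n)%N then false else if i == n then true else x (i - n.+1)%N.

Definition cantor_shift n (x : cantor_space) : cantor_space :=
  fun i => x (n.+1 + i)%N.

Lemma cantor_embed_continuous n : continuous (cantor_embed n).
Proof.
apply: continuous_cantor => i; rewrite /cantor_embed.
case: (i < n)%N; first by move=> x; exact: cvg_cst.
case: (i == n); first by move=> x; exact: cvg_cst.
exact: cantor_coord_continuous.
Qed.

Lemma cantor_shift_continuous n : continuous (cantor_shift n).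
Proof. apply: continuous_cantor => i; exact: cantor_coord_continuous. Qed.

Lemma cantor_embedK n : cancel (cantor_embed n) (cantor_shift n).
Proof.
move=> x; apply/funext => i; rewrite /cantor_shift /cantor_embed.
rewrite ltnNge ltnW ?leq_addr//= gtn_eqF ?leq_addr//.
by rewrite addnC addnK.
Qed.

Lemma cantor_pieceP n x : cantor_piece n x <->
  (forall i, (i < n)%N -> x i = false) /\ x n = true.
Proof.
rewrite /cantor_piece /cantor_cylinder /= size_rcons size_nseq.
split=> [xn|[x0 x1] i].
  split=> [i ni|].
    by rewrite (xn _ (leqW ni)) nth_rcons size_nseq ni nth_nseq ni.
  by rewrite (xn _ (leqnn _)) nth_rcons size_nseq ltnn eqxx.
rewrite nth_rcons size_nseq ltnS leq_eqVlt => /predU1P[->|ni].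
  by rewrite ltnn eqxx.
by rewrite ni nth_nseq ni x0.
Qed.

Lemma cantor_embed_piece n x : cantor_piece n (cantor_embed n x).
Proof.
apply/cantor_pieceP; rewrite /cantor_embed ltnn eqxx; split=> // i ->//.
Qed.

Lemma cantor_piece_inj m n x : cantor_piece m x -> cantor_piece n x -> m = n.
Proof.
move=> /cantor_pieceP[xm0 xm1] /cantor_pieceP[xn0 xn1].
case: (ltngtP m n) => // mn.
  by move: xm1; rewrite xn0.
by move: xn1; rewrite xm0.
Qed.

Variable A : nat -> set cantor_space.

Definition cantor_glue : set cantor_space :=
  \bigcup_n (cantor_shift n @^-1` A n `&` cantor_piece n).

(** Each glued set is a continuous preimage of the whole, so the whole is at least as complex as
    each of them. *)
Lemma cantor_glue_embed n : cantor_embed n @^-1` cantor_glue = A n.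
Proof.
apply/seteqP; split=> x /=.
  move=> -[m _ [/= Am /cantor_piece_inj/(_ (@cantor_embed_piece n x)) mn]].
  by move: Am; rewrite mn cantor_embedK.
move=> Ax; exists n => //; split; last exact: cantor_embed_piece.
by rewrite /= cantor_embedK.
Qed.

End gluing.

Lemma cantor_glue_Sigma0 a A : oone < a -> (forall n, Sigma0 a (A n)) ->
  Sigma0 a (cantor_glue A).
Proof.
move=> a1 SA; apply: (Sigma0_bigcup_nat cantor_Fsigma_open) => n.
apply: (Sigma0I_closed cantor_Fsigma_open) => //; last exact: cantor_cylinder_closed.
exact: Sigma0_preimage (@cantor_shift_continuous n) _.
Qed.

(** Up to the closed remainder outside all pieces, complementation acts piece by piece; hence gluing
    keeps ambiguous classes above level one. *)
Lemma cantor_glueC A : ~` cantor_glue A =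
  ~` (\bigcup_n cantor_piece n) `|` cantor_glue (fun n => ~` A n).
Proof.
apply/seteqP; split=> x.
  move=> nx; have [[n _ xn]|nxn] := EM ((\bigcup_n cantor_piece n) x); last by left.
  by right; exists n => //; split=> // Ax; apply: nx; exists n.
move=> [nx [n _ [_ xn]]|[n _ [nA xn]] [m _ [Am xm]]].
  by apply: nx; exists n.
by apply: nA; rewrite (cantor_piece_inj xn xm).
Qed.

Lemma cantor_glue_Delta0 a A : oone < a ->
  (forall n, Sigma0 a (A n) /\ Pi0 a (A n)) -> Delta0 a (cantor_glue A).
Proof.
move=> a1 DA; split; first by apply: cantor_glue_Sigma0 => // n; case: (DA n).
rewrite /Pi0 /= cantor_glueC; apply: (Sigma0U cantor_Fsigma_open).
  apply: (Pi0_lt_Sigma0 cantor_Fsigma_open (lexx _) a1); apply/Pi0_one.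
  apply: open_closedC; apply: bigcup_open => n _; exact: cantor_cylinder_open.
by apply: cantor_glue_Sigma0 => // n; case: (DA n).
Qed.

Lemma exact_Delta0_cantor a : oone < a ->
  exists A : set cantor_space, exact_Delta0 a A.
Proof.
move=> a1; have [b [ba bsurj]] := omega1_lt_surj a1.
have /choice[E EP] : forall n, exists A : set cantor_space, exact_Sigma0 (b n) A.
  by move=> n; apply: exact_Sigma0_cantor; have /andP[] := ba n.
have SE n : Sigma0 a (E n).
  have [+ _] := EP n; apply: (Sigma0_le cantor_Fsigma_open).
  by have /andP[_ /ltW] := ba n.
have SCE n : Sigma0 a (~` E n).
  have /andP[b1 bna] := ba n; apply: (Pi0_lt_Sigma0 cantor_Fsigma_open b1 bna).
  by apply/Pi0C; have [] := EP n.
(* Piece 2n carries [E n] and piece 2n+1 its complement. Pulling back to one or the other turns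
   either class at a smaller level into [Pi0 (b n) (E n)], which is false. *)
exists (cantor_glue (fun n => if odd n then ~` E n./2 else E n./2)); split.
  by apply: cantor_glue_Delta0 => // n; case: ifP; rewrite /Pi0 /= ?setCK.
move=> c c1 ca; have [n bn] : exists n, b n = c by apply: bsurj; rewrite c1.
have [SEn] := EP n; rewrite bn; apply: contra_not => -[SG|PG].
- rewrite /Pi0 /=; move: (Sigma0_preimage (@cantor_embed_continuous n.*2.+1) SG).
  by rewrite cantor_glue_embed /= odd_double /= uphalf_double.
- move: (Pi0_preimage (@cantor_embed_continuous n.*2) PG).
  by rewrite cantor_glue_embed /= odd_double /= doubleK.
Qed.

(** * Spreading a subset of the Cantor space over the line *)

Section cantor_sum.
Local Open Scope ring_scope.
Context {R : realType}.
Implicit Types (x y z : cantor_space).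

(** The geometric factor is 2 / 3^(i+1), so [cantor_sum] parametrizes the ternary Cantor set. *)
Definition cantor_term y (i : nat) : R :=
  (y i : bool)%:R * geometric (2 / 3) (1 / 3) i.

Definition cantor_sum y : R := limn (series (cantor_term y)).

Lemma geometric_third_ge0 i : 0 <= geometric (2 / 3) (1 / 3) i :> R.
Proof. by rewrite /geometric /= mulr_ge0 ?exprn_ge0//; lra. Qed.

Lemma cvg_geometric_third : series (geometric (2 / 3) (1 / 3)) @ \oo --> (1 : R).
Proof.
have : `|1 / 3 : R| < 1 by rewrite ger0_norm; lra.
move=> /(@cvg_geometric_series _ (2 / 3)).
by rewrite (_ : 1 - 1 / 3 = 2 / 3 :> R) ?divff ?mulf_neq0 ?invr_eq0 ?pnatr_eq0//; lra.
Qed.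

Lemma cantor_term_ge0 y i : 0 <= cantor_term y i.
Proof. by rewrite mulr_ge0// geometric_third_ge0. Qed.

Lemma cantor_term_le y i : cantor_term y i <= geometric (2 / 3) (1 / 3) i.
Proof.
by rewrite ler_piMl ?geometric_third_ge0//; case: (y i); rewrite ?ler01.
Qed.

Lemma is_cvg_cantor_sum y : cvgn (series (cantor_term y)).
Proof.
apply: (series_le_cvg (@cantor_term_ge0 y) geometric_third_ge0 (@cantor_term_le y)).
by apply/cvg_ex; exists 1; exact: cvg_geometric_third.
Qed.

Lemma cantor_sum_ge0 y : 0 <= cantor_sum y.
Proof.
apply: limr_ge; first exact: is_cvg_cantor_sum.
by apply: nearW => n; apply: sumr_ge0 => i _; exact: cantor_term_ge0.
Qed.

Lemma cantor_sum_le1 y : cantor_sum y <= 1.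
Proof.
rewrite -(cvg_lim _ cvg_geometric_third)//.
apply: lim_series_le; [exact: is_cvg_cantor_sum| |exact: cantor_term_le].
by apply/cvg_ex; exists 1; exact: cvg_geometric_third.
Qed.

(** Self-similarity of the Cantor set; the inductions for continuity and injectivity rest on it. *)
Lemma cantor_sum_shift y :
  cantor_sum y = ((y 0%N : bool)%:R * 2 + cantor_sum (cantor_shift 0 y)) / 3.
Proof.
apply/cvg_lim => //; rewrite -cvg_shiftS /=.
rewrite (_ : (fun n => _) = (fun n => (y 0%N : bool)%:R * 2 / 3 +
  3^-1 * series (cantor_term (cantor_shift 0 y)) n)); last first.
  apply/funext => n; rewrite /series /= big_nat_recl//= mulr_sumr.
  congr +%R; first by rewrite /cantor_term /= expr0 mulr1 mulrA.
  apply: eq_bigr => i _; rewrite /cantor_term /cantor_shift /= add1n exprS.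
  by case: (y i.+1) => /=; lra.
rewrite mulrDl (mulrC (cantor_sum _)).
by apply: cvgD; [exact: cvg_cst|apply: cvgMr; exact: is_cvg_cantor_sum].
Qed.

Lemma cantor_sum_dist n x y : (forall i, (i < n)%N -> x i = y i) ->
  `|cantor_sum x - cantor_sum y| <= 3^-1 ^+ n.
Proof.
elim: n x y => [|n IH] x y xy.
  rewrite expr0 ler_norml; have := cantor_sum_ge0 x; have := cantor_sum_ge0 y.
  have := cantor_sum_le1 x; have := cantor_sum_le1 y; lra.
rewrite (cantor_sum_shift x) (cantor_sum_shift y) xy// -mulrBl.
rewrite opprD addrACA subrr add0r exprSr normrM (ger0_norm (_ : 0 <= 3^-1))//.
rewrite ler_pM2r//; apply: IH => i ni; exact: xy.
Qed.

Lemma cantor_sum_inj : injective cantor_sum.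
Proof.
(* Sums with first digit 0 are at most 1/3, those with first digit 1 at least 2/3. *)
have head x y : cantor_sum x = cantor_sum y ->
    x 0%N = y 0%N /\ cantor_sum (cantor_shift 0 x) = cantor_sum (cantor_shift 0 y).
  rewrite (cantor_sum_shift x) (cantor_sum_shift y).
  have := cantor_sum_ge0 (cantor_shift 0 x).
  have := cantor_sum_ge0 (cantor_shift 0 y).
  have := cantor_sum_le1 (cantor_shift 0 x).
  have := cantor_sum_le1 (cantor_shift 0 y).
  by case: (x 0%N); case: (y 0%N) => /= *; split=> //; lra.
move=> x y xy; apply/funext => i.
elim: i x y xy => [|i IH] x y /head[x0 xy]; first exact: x0.
exact: (IH _ _ xy).
Qed.

Lemma cantor_sum_continuous : continuous cantor_sum.
Proof.
move=> x; apply/cvgrPdist_lt => e e0.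
have [n ne] : exists n, 3^-1 ^+ n < e.
  have : (fun n => 3^-1 ^+ n : R) @ \oo --> 0.
    by apply: cvg_expr; rewrite ger0_norm; lra.
  move=> /cvgrPdist_lt/(_ _ e0)[n _ nP]; exists n.
  have := nP n (leqnn n); rewrite sub0r normrN; exact/le_lt_trans/ler_norm.
near=> y; apply: le_lt_trans ne; apply: cantor_sum_dist => i ni.
have : cantor_cylinder (mkseq x n) y by near: y; exact: nbhs_cantor_cylinder.
by move=> /(_ i); rewrite size_mkseq nth_mkseq// => ->.
Unshelve. all: by end_near. Qed.

(** Disjoint supports involve no carry, so the series add term by term. *)
Lemma cantor_sumD y z : (forall i, ~~ (y i && z i)) ->
  cantor_sum (fun i => y i || z i) = cantor_sum y + cantor_sum z.
Proof.
move=> yz; apply/cvg_lim => //.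
rewrite (_ : series _ = series (cantor_term y) + series (cantor_term z)); last first.
  apply/funext => n; rewrite /series /= fctE -big_split/=; apply: eq_bigr => i _.
  rewrite /cantor_term -mulrDl; have := yz i.
  by case: (y i); case: (z i) => //= _; rewrite ?addr0 ?add0r.
by apply: cvgD; exact: is_cvg_cantor_sum.
Qed.

End cantor_sum.

(** * Layers, their union, and its Borel class *)

Section spread.
Local Open Scope ring_scope.
Context {R : realType}.
Implicit Types (x y z t : cantor_space) (A : set cantor_space).

(* The fibres of [level] partition [nat] into infinite blocks; block 0 consists of
   the even indices. *)
Definition level (i : nat) : nat := logn 2 i.+1.

Lemma level_double j : level j.*2 = 0%N.
Proof. by rewrite /level lognE dvdn2 /= odd_double. Qed.

(** The index i with i + 1 = 2^n (2j+1) is the j-th member of block n. *)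
Lemma level_code n j : level (2 ^ n * j.*2.+1).-1 = n.
Proof.
rewrite /level prednK ?muln_gt0 ?expn_gt0// lognM ?expn_gt0// pfactorK//.
by rewrite [X in (n + X)%N]level_double addn0.
Qed.

Definition layer_support n : set cantor_space :=
  [set y | forall i, (n < level i)%N -> y i = false].

Definition cantor_even y : cantor_space := fun j => y j.*2.

(** Since [cantor_sum] has values in [0, 1], the offset 2n puts the layers into intervals separated
    by gaps. *)
Definition layer n A : set R :=
  [set cantor_sum y + n.*2%:R | y in layer_support n `&` cantor_even @^-1` A].

Definition spread A : set R := \bigcup_n layer n A.

Lemma cantor_even_continuous : continuous cantor_even.
Proof. apply: continuous_cantor => i; exact: cantor_coord_continuous. Qed.

Lemma layer_support_closed n : closed (layer_support n).
Proof.
rewrite (_ : layer_support n = \bigcap_(i in [set i | (n < level i)%N])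
  [set y : cantor_space | y i = false]) //.
apply: closed_bigI => i _; rewrite -openC.
exact: (@cantor_coord_open i (~` [set false])).
Qed.

Lemma layer_itv n A r : layer n A r -> n.*2%:R <= r <= n.*2%:R + 1.
Proof.
move=> [y _ <-]; have := @cantor_sum_ge0 R y; have := @cantor_sum_le1 R y.
by move=> *; apply/andP; lra.
Qed.

Lemma even_itv_inj m n (r : R) : m.*2%:R <= r <= m.*2%:R + 1 ->
  n.*2%:R <= r <= n.*2%:R + 1 -> m = n.
Proof.
have lt k l : (k < l)%N -> k.*2%:R + 1 < l.*2%:R :> R.
  by move=> kl; rewrite natr1 ltr_nat ltn_Sdouble.
move=> /andP[mr rm] /andP[nr rn].
by case: (ltngtP m n) => // /lt ?; exfalso; lra.
Qed.

Lemma layer_index m n A A' r : layer m A r -> layer n A' r -> m = n.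
Proof. by move=> /layer_itv mr /layer_itv; exact: even_itv_inj mr. Qed.

(** A layer is the continuous image of a closed, hence compact, part of the Cantor space. *)
Lemma layer_closed n A : closed A -> closed (layer n A).
Proof.
move=> cA; apply: compact_closed; first exact: Rhausdorff.
apply: continuous_compact.
  apply: continuous_subspaceT => y; apply: cvgD; last exact: cvg_cst.
  exact: cantor_sum_continuous.
apply: subclosed_compact cantor_space_compact _ => //.
apply: closedI; first exact: layer_support_closed.
by apply: preimage_closed => // y _; exact: cantor_even_continuous.
Qed.

(** Cutting with an interval recovers a layer, so layers inherit being Borel from the spread set. *)
Lemma spread_layer n A : spread A `&` `[n.*2%:R, n.*2%:R + 1] = layer n A.
Proof.
apply/seteqP; split=> r /=; rewrite in_itv /=; last first.
  by move=> nr; split; [exists n|exact: layer_itv nr].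
by move=> [[m _ mr] /(even_itv_inj (layer_itv mr)) <-].
Qed.

(** Below 2m only the finitely many layers of index less than m occur. *)
Lemma spread_closed A : closed A -> closed (spread A).
Proof.
move=> cA; rewrite -openC openE => r nr.
have [m rm] : exists m, r < m.*2%:R.
  exists (Num.truncn r).+1; apply: lt_le_trans (truncnS_gt r) _.
  by rewrite ler_nat -addnn leq_addr.
have c1 : closed (\bigcup_(n < m) layer n A).
  by apply: closed_bigcup => [|n _]; [exact: finite_II|exact: layer_closed].
have : nbhs r (~` (\bigcup_(n < m) layer n A) `&` [set s | s < m.*2%:R]).
  apply: filterI; last by apply: open_nbhs_nbhs; split => //; exact: open_lt.
  apply: open_nbhs_nbhs; split; first exact: closed_openC.
  by move=> [n _ nrA]; apply: nr; exists n.
apply: filterS => s [ns sm] [n _ sn]; apply: ns; exists n => //=.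
rewrite ltnNge; apply/negP => mn.
have m2n : m.*2%:R <= n.*2%:R :> R by rewrite ler_nat leq_double.
by have /andP[n2s _] := layer_itv sn; move: sm => /= sm; lra.
Qed.

(** A point determines its layer and, by injectivity of [cantor_sum], its digit sequence. *)
Lemma spreadC A : spread (~` A) = spread setT `&` ~` spread A.
Proof.
apply/seteqP; split=> r.
  move=> [n _ [y [sy nA] yr]]; split; first by exists n => //; exists y.
  move=> [m _ mr]; have nm : n = m.
    by apply: (layer_index (A := ~` A)) mr; exists y.
  case: mr => z [_ Az]; rewrite -yr nm => /addIr/cantor_sum_inj zy.
  by apply: nA; rewrite /= -zy.
move=> [[n _ [y [sy _] yr]] nA]; exists n => //; exists y => //; split=> // Ay.
by apply: nA; exists n => //; exists y.
Qed.

Lemma spread_bigcup (F : nat -> set cantor_space) :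
  spread (\bigcup_n F n) = \bigcup_n spread (F n).
Proof.
apply/seteqP; split=> r.
  by move=> [n _ [y [sy [k _ Fy]] yr]]; exists k => //; exists n => //; exists y.
move=> [k _ [n _ [y [sy Fy] yr]]]; exists n => //; exists y => //.
by split=> //; exists k.
Qed.

(** One induction gives both halves: the Pi half at smaller levels yields the union, whose
    complement inside the closed set [spread setT] yields the next Pi half. At level one only the Pi
    half has content. *)
Lemma spread_Sigma0 a A : Sigma0 a A ->
  Pi0 a (spread (~` A)) /\ ((oone < a)%O -> Sigma0 a (spread A)).
Proof.
have RF := @Fsigma_open_pseudometric R R.
elim=> {a A} [U oU|a b F ba _ IH].
  split; last by rewrite ltxx.
  by apply/Pi0_one; apply: spread_closed; rewrite closedC.
have SF : Sigma0 a (spread (\bigcup_n F n)).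
  rewrite spread_bigcup; apply: (Sigma0_bigcup ba) => n.
  by have [+ _] := IH n; rewrite setCK.
split=> //; rewrite spreadC; apply: (Pi0I RF).
  apply: (Pi0_closed_ge1 RF); first exact: (Sigma0_gt_bot SF).
  exact: spread_closed closedT.
by apply/Pi0C.
Qed.

Lemma spread_Pi0 a A : Pi0 a A -> Pi0 a (spread A).
Proof. by move=> /spread_Sigma0[+ _]; rewrite setCK. Qed.

Definition cantor_unspread x : cantor_space :=
  fun i => if odd i then false else x i./2.

Definition spread_section x : R := cantor_sum (cantor_unspread x).

Lemma spread_section_continuous : continuous spread_section.
Proof.
have c : continuous cantor_unspread.
  apply: continuous_cantor => i; rewrite /cantor_unspread.
  case: (odd i); first by move=> x; exact: cvg_cst.
  exact: cantor_coord_continuous.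
move=> x; apply: continuous_comp; first exact: c.
exact: cantor_sum_continuous.
Qed.

Lemma cantor_unspreadK : cancel cantor_unspread cantor_even.
Proof.
move=> x; apply/funext => i.
by rewrite /cantor_even /cantor_unspread odd_double doubleK.
Qed.

(** The section takes values in layer 0, where injectivity of [cantor_sum] recovers the sequence.
    Being continuous, it transfers lower bounds on the class from [A] to [spread A]. *)
Lemma spread_section_preimage A : spread_section @^-1` spread A = A.
Proof.
have s0 x : layer_support 0 (cantor_unspread x).
  move=> i; rewrite /cantor_unspread; case: ifP => // /negbT oi.
  by rewrite -(even_halfK oi) level_double.
apply/seteqP; split=> x /=.
  move=> [n _ nx]; have n0 : n = 0%N.
    apply: (layer_index (A' := setT)) nx _.
    by exists (cantor_unspread x) => //; rewrite addr0.
  move: nx; rewrite n0 => -[y [_ Ay]]; rewrite addr0 => /cantor_sum_inj yx.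
  by move: Ay; rewrite yx /= cantor_unspreadK.
move=> Ax; exists 0%N => //; exists (cantor_unspread x); last by rewrite addr0.
by split=> //=; rewrite cantor_unspreadK.
Qed.

(** Writes [t] on block n: when i + 1 = 2^n (2j+1), the quotient of i + 1 by 2^(n+1) is j. *)
Definition level_code_seq n t : cantor_space :=
  fun i => (level i == n) && t (i.+1 %/ 2 ^ n.+1)%N.

Lemma level_code_seq_inj n : injective (level_code_seq n).
Proof.
move=> s t st; apply/funext => j.
have := congr1 (@^~ (2 ^ n * j.*2.+1).-1) st.
rewrite /level_code_seq level_code eqxx /= prednK ?muln_gt0 ?expn_gt0//.
rewrite expnSr divnMA mulKn ?expn_gt0//.
by rewrite -[j.*2.+1]addn1 -muln2 divnMDl// addn0.
Qed.

(** The summand 2 leads from layer n to layer n+1; the rest fills block n+1, where sequences of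
    layer n vanish. *)
Definition layer_shift n t : R := 2 + cantor_sum (level_code_seq n.+1 t).

Let disj n y t : layer_support n y ->
  forall i, ~~ (y i && level_code_seq n.+1 t i).
Proof.
move=> sy i; rewrite /level_code_seq; case: eqP => [li|]; last by rewrite andbF.
by rewrite sy // li.
Qed.

(** Filling block n+1 causes no carry and leaves block 0, which decides membership in [A],
    unchanged. *)
Lemma layer_translate_sub n A t :
  translate (layer n A) (layer_shift n t) `<=` layer n.+1 A.
Proof.
move=> _ [_ [y [sy Ay] <-] <-].
exists (fun i => y i || level_code_seq n.+1 t i); last first.
  rewrite cantor_sumD; last exact: disj.
  by rewrite /layer_shift doubleS -[n.*2.+2]addn2 natrD; lra.
split.
  move=> i ni; rewrite sy; last exact: ltnW.
  by rewrite /level_code_seq gtn_eqF.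
rewrite /= (_ : cantor_even _ = cantor_even y)//; apply/funext => j.
by rewrite /cantor_even /level_code_seq level_double /= orbF.
Qed.

(** A common point has a single digit sequence, whose block n+1 spells both [s] and [t]. *)
Lemma layer_translate_disjoint n A s t r :
  translate (layer n A) (layer_shift n s) r ->
  translate (layer n A) (layer_shift n t) r -> s = t.
Proof.
move=> [_ [y [sy _] <-] yr] [_ [z [sz _] <-] zr].
apply: (@level_code_seq_inj n.+1).
have /cantor_sum_inj e : cantor_sum (fun i => y i || level_code_seq n.+1 s i) =
   cantor_sum (fun i => z i || level_code_seq n.+1 t i) :> R.
  rewrite !cantor_sumD; [|exact: disj..].
  by move: yr zr; rewrite /layer_shift; lra.
apply/funext => i; move: (congr1 (@^~ i) e) => /=.
rewrite /level_code_seq; case: eqP => //= li.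
by rewrite sy ?sz ?li.
Qed.

End spread.

(** * Invariant measures *)

Section invariant_measures.
Local Open Scope ring_scope.

Lemma Borel_measurableE (R : realType) :
  @Borel R = (measurable : set (set (measurableTypeR R))).
Proof.
apply/seteqP; split.
  apply: smallest_sub; first exact: sigma_algebra_measurable.
  by move=> U; exact: open_measurable.
rewrite [X in X `<=` _](RGenOpens.measurableE R).
apply: smallest_sub; first exact: smallest_sigma_algebra.
move=> _ [a [b ->]]; apply: sub_sigma_algebra; exact: interval_open.
Qed.

Lemma translateE (R : realType) (A : set R) t :
  translate A t = (fun x => x - t) @^-1` A.
Proof.
apply/seteqP; split=> [_ [x Ax <-]|x Ax] /=; first by rewrite addrK.
by exists (x - t) => //; rewrite subrK.
Qed.

Lemma measurable_subr (R : realType) (t : R) :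
  measurable_fun [set: measurableTypeR R]
    (fun x : measurableTypeR R => x - t : measurableTypeR R).
Proof.
by apply: continuous_measurable_fun => x; apply: cvgB => //; exact: cvg_cst.
Qed.

(** The pushforward under subtraction of [t] agrees with Lebesgue measure on half-open intervals,
    hence everywhere by uniqueness. *)
Lemma lebesgue_measure_translate (R : realType) (A : set R) t :
  measurable (A : set (measurableTypeR R)) ->
  measurable (translate A t : set (measurableTypeR R)) /\
  lebesgue_measure (translate A t) = lebesgue_measure A.
Proof.
move=> mA; rewrite translateE; split.
  by rewrite -[X in measurable X]setTI; exact: measurable_subr.
have := @lebesgue_measure_unique R
  (measure_function_pushforward__canonical__measure_function_Measure
     lebesgue_measure (measurable_subr t)).
move=> /(_ _ A mA) ->//= X [[a b] /= _ <-].
rewrite /pushforward (_ : _ @^-1` _ = `]a + t, b + t]%classic); last first.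
  by apply/seteqP; split=> x /=; rewrite !in_itv /= ltrBrDr lerBlDr.
rewrite !lebesgue_measure_itv /= !lte_fin ltrD2r.
by case: ifP => // _; rewrite -!EFinB; congr EFin; lra.
Qed.

(** Pushing forward along this identity places Lebesgue measure on the sigma-algebra [Borel], as
    [immeasurable] demands. *)
Lemma measurable_id_Borel (R : realType) :
  measurable_fun [set: measurableTypeR R]
    (fun x : measurableTypeR R => x : g_sigma_algebraType (@Borel R)).
Proof.
move=> _ Y mY; rewrite setTI preimage_id -Borel_measurableE.
by rewrite -[X in X Y](sigma_algebra_id (smallest_sigma_algebra _ _)).
Qed.

(** Lebesgue measure is a counterexample: a ball inside [U] makes it positive, and balls of radius n
    around 0 make [U] sigma-finite. *)
Lemma open_not_immeasurable (R : realType) (U : set R) :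
  open U -> ~ immeasurable U.
Proof.
move=> oU [_ [x Ux]].
have sB : sigma_algebra setT (@Borel R) by exact: smallest_sigma_algebra.
pose nu := measure_function_pushforward__canonical__measure_function_Measure
  lebesgue_measure (@measurable_id_Borel R).
have nuE A : nu A = lebesgue_measure A by [].
move=> /(_ (@Borel R) sB (@subset_refl _ _) nu)[A t|nuU|].
- by rewrite !nuE Borel_measurableE; exact: lebesgue_measure_translate.
- have : nbhs x U by exact: open_nbhs_nbhs.
  rewrite -nbhs_ballE => -[e /= e0 eU].
  have : (lebesgue_measure (ball x e) <= nu U)%E.
    rewrite nuE; apply: le_measure => //; rewrite inE.
      exact: measurable_ball.
    exact: open_measurable.
  by rewrite nuU lebesgue_measure_ball ?(ltW e0)// lee_fin leNgt mulrn_wgt0.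
- apply; exists (fun n => U `&` ball 0 n%:R).
    rewrite -setI_bigcupr; apply/esym/setIidPl => y _.
    exists (Num.truncn `|y|).+1 => //=.
    by rewrite -ball_normE /ball_ /= sub0r normrN truncnS_gt.
  move=> n; split.
    apply: sub_sigma_algebra; apply: sub_sigma_algebra; apply: openI => //.
    exact: ball_open.
  have foo : (lebesgue_measure (ball (0 : R)%R n%:R%R) < +oo)%E.
    by rewrite lebesgue_measure_ball// ltry.
  rewrite nuE; apply: le_lt_trans foo.
  apply: le_measure; rewrite ?inE//; last exact: measurable_ball.
  by apply: measurableI; [exact: open_measurable|exact: measurable_ball].
Qed.

(** Pigeonhole: if no [D i] were null, infinitely many would meet one set [F n] of finite measure in
    more than a fixed positive amount. *)
Lemma sigma_finite_uncountable_disjoint d (T : measurableType d) (R : realType)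
    (mu : {measure set T -> \bar R}) (B : set T) (I : pointedType) (D : I -> set T) :
  sigma_finite B mu -> ~ countable [set: I] ->
  (forall i, measurable (D i)) -> (forall i, D i `<=` B) ->
  trivIset setT D -> exists i, mu (D i) = 0%E.
Proof.
move=> [F BF mF] ncI mD DB tD; apply: contrapT => nD.
have DF i : exists nm : nat * nat, (nm.2.+1%:R^-1%:E < mu (D i `&` F nm.1))%E.
  apply: contrapT => nnm; apply: nD; exists i.
  apply: measure_negligible => //.
  rewrite (_ : D i = \bigcup_n (D i `&` F n)); last first.
    by rewrite -setI_bigcupr -BF; apply/esym/setIidPl; exact: DB.
  apply: negligible_bigcup => n.
  have mDF : measurable (D i `&` F n) by apply: measurableI => //; case: (mF n).
  exists (D i `&` F n); split => //; apply/eqP; rewrite eq_le measure_ge0 andbT.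
  apply/lee_addgt0Pr => e e0; rewrite add0e.
  have me : ((Num.truncn e^-1).+1%:R^-1 <= e).
    by rewrite invf_ple ?posrE// ltW// truncnS_gt.
  rewrite leNgt; apply/negP => eDF; apply: nnm; exists (n, Num.truncn e^-1).
  by apply: le_lt_trans eDF; rewrite lee_fin.
have /choice[c cP] := DF.
(* There are countably many pairs; if all fibres of [c] were finite, the index set would be
   countable. *)
have [nm nmI] : exists nm, infinite_set (c @^-1` [set nm]).
  apply: contrapT => fin; apply: ncI.
  rewrite (_ : setT = \bigcup_nm c @^-1` [set nm]); last first.
    by apply/seteqP; split=> // i _; exists (c i).
  apply: bigcup_countable => // nm _; apply: finite_set_countable.
  by apply: contrapT => inf; apply: fin; exists nm.
have [mFn Fnoo] := mF nm.1.
have [g gP ginj] : exists2 g : nat -> I, forall k, c (g k) = nm & injective g.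
  move/infiniteP/pcard_leP: nmI => -[g]; exists g.
    by move=> k; exact: (@funS _ _ _ _ g k).
  by move=> k l; apply: inj; rewrite inE.
pose G k := D (g k) `&` F nm.1.
have GP k : (nm.2.+1%:R^-1%:E < mu (G k))%E by have := cP (g k); rewrite gP.
have mG k : measurable (G k) by exact: measurableI.
have tG : trivIset setT G.
  move=> k l _ _ [x [[xk _] [xl _]]]; apply: ginj; apply: tD => //.
  by exists x.
have FG N : ((N%:R * nm.2.+1%:R^-1)%:E <= mu (F nm.1))%E.
  apply: (@le_trans _ _ (mu (\bigcup_k G k))); last first.
    apply: le_measure; rewrite ?inE//; first exact: bigcupT_measurable.
    by move=> x [k _ []].
  rewrite measure_bigcup//.
  apply: le_trans (nneseries_lim_ge N _) => //.
  under [leRHS]eq_bigl do rewrite in_setT.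
  rewrite mulr_natl -[in leLHS](subn0 N) -sumr_const_nat -sumEFin.
  by apply: lee_sum => k _; rewrite ltW// GP.
have [r Fr] : exists r, mu (F nm.1) = r%:E.
  by exists (fine (mu (F nm.1))); rewrite fineK// ge0_fin_numE.
(* This number of disjoint pieces already exceeds the measure [r] of [F nm.1]. *)
have := FG (Num.truncn (r * nm.2.+1%:R)).+1.
rewrite Fr lee_fin leNgt ltr_pdivlMr//.
by rewrite truncnS_gt.
Qed.

(** Some translate is null by the pigeonhole argument, and invariance carries this back to [C]. *)
Lemma translation_invariant_null (R : realType) (S : set (set R))
    (mu : {measure set (g_sigma_algebraType S) -> \bar R})
    (B C : set R) (I : pointedType) (shift : I -> R) :
  sigma_algebra setT S -> translation_invariant S mu ->
  sigma_finite (B : set (g_sigma_algebraType S)) mu -> S C ->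
  ~ countable [set: I] ->
  (forall i, translate C (shift i) `<=` B) ->
  trivIset setT (fun i => translate C (shift i)) -> mu C = 0%E.
Proof.
move=> sS tmu sfB SC ncI CB tC.
have [|i] := sigma_finite_uncountable_disjoint sfB ncI _ CB tC.
  by move=> i; apply: sub_sigma_algebra; have [] := tmu C (shift i) SC.
by have [_ ->] := tmu C (shift i) SC.
Qed.

Lemma cantor_space_uncountable : ~ countable [set: cantor_space].
Proof.
move=> /countable_injP[f finj]; apply: powerset_nat_uncountable.
apply/countable_injP; exists (fun A => f (fun n => `[< (A : set nat) n >])).
move=> A B _ _ /finj AB; apply/funext => n; apply/propext.
have := congr1 (@^~ n) (AB (in_setT _) (in_setT _)) => /= e.
by split=> h; apply/asboolP; [rewrite -e|rewrite e]; exact/asboolP.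
Qed.

Lemma spread_immeasurable (R : realType) (A : set cantor_space) :
  A !=set0 -> Borel (spread A : set R) -> immeasurable (spread A : set R).
Proof.
move=> [x Ax] BA; split=> //.
  exists (spread_section x); move: Ax.
  by rewrite -[X in X x -> _](@spread_section_preimage R).
have BL n : Borel (layer n A : set R).
  rewrite -spread_layer; move: BA; rewrite !Borel_measurableE => mA.
  by apply: measurableI => //; exact: measurable_itv.
move=> S sS BS mu tmu.
have [sf|] := EM (sigma_finite (spread A : set (g_sigma_algebraType S)) mu);
  last by right.
left; apply: measure_negligible; first by apply: sub_sigma_algebra; exact: BS.
apply: negligible_bigcup => n.
exists (layer n A); split=> //; first by apply: sub_sigma_algebra; exact: BS.
apply: (translation_invariant_null (shift := layer_shift n) sS tmu sf _
  cantor_space_uncountable).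
- exact: BS.
- by move=> t r /layer_translate_sub nr; exists n.+1.
- by move=> s t _ _ [r [/= rs rt]]; exact: layer_translate_disjoint rs rt.
Qed.

End invariant_measures.

(** * Transfer of exact classes from the Cantor space to the line *)

Theorem theorem3p1 (R : realType) :
  (forall alpha : omega1, oone <= alpha ->
     exists B : set R, immeasurable B /\ exact_Pi0 alpha B) /\
  (forall alpha : omega1, oone <= alpha ->
     ((exists B : set R, immeasurable B /\ exact_Sigma0 alpha B) <->
      otwo <= alpha)) /\
  (forall alpha : omega1, oone <= alpha ->
     ((exists B : set R, immeasurable B /\ exact_Delta0 alpha B) <->
      otwo <= alpha)).
Proof.
have cE := @spread_section_continuous R.
have SE a A : Sigma0 a (spread A : set R) -> Sigma0 a A.
  by move=> /(Sigma0_preimage cE); rewrite spread_section_preimage.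
have PE a A : Pi0 a (spread A : set R) -> Pi0 a A.
  by move=> /(Pi0_preimage cE); rewrite spread_section_preimage.
have S0 a : oone <= a -> Sigma0 a (set0 : set cantor_space).
  by move=> a1; apply: (Sigma0_open_ge1 cantor_Fsigma_open a1); exact: open0.
have P0 a : oone <= a -> Pi0 a (set0 : set cantor_space).
  by move=> a1; apply: (Pi0_closed_ge1 cantor_Fsigma_open a1); exact: closed0.
(* Level one would make [B] open; the Delta case also uses this, through its Sigma half. *)
have gt1 (a : omega1) (B : set R) : oone <= a -> immeasurable B ->
    Sigma0 a B -> otwo <= a.
  move=> a1 iB SB; rewrite otwo_le lt_neqAle a1 andbT; apply/eqP => e.
  by move: SB iB; rewrite -e => /Sigma0_one/open_not_immeasurable.
split=> [a a1|]; last split=> a a1; last first.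
- split=> [[B [iB [[SB _] _]]]|]; first exact: gt1 iB SB.
  rewrite otwo_le => {}a1; have [A [[SA PA] nA]] := exact_Delta0_cantor a1.
  have SB : Sigma0 a (spread A : set R) by have [_] := @spread_Sigma0 R _ _ SA; exact.
  exists (spread A); split.
    apply: spread_immeasurable; last exact: Sigma0_Borel SB.
    (* An exact set is nonempty because the empty set already has class [oone]. *)
    apply/set0P/eqP => A0; apply: (nA oone) => //; left; rewrite A0; exact: S0.
  split; first by split=> //; exact: spread_Pi0.
  by move=> b b1 ba [/SE|/PE] ?; apply: (nA b) => //; [left|right].
- split=> [[B [iB [SB _]]]|]; first exact: gt1 iB SB.
  rewrite otwo_le => a1'; have [A [SA nPA]] := exact_Sigma0_cantor a1.
  have SB : Sigma0 a (spread A : set R) by have [_] := @spread_Sigma0 R _ _ SA; exact.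
  exists (spread A); split; last by split=> // /PE.
  apply: spread_immeasurable; last exact: Sigma0_Borel SB.
  by apply/set0P/eqP => A0; apply: nPA; rewrite A0; exact: P0.
(* For the Pi class, spread the complement of an exact Sigma set; this works at level one too, as
   closed sets spread to closed sets. *)
- have [A [SA nPA]] := exact_Sigma0_cantor a1.
  have [PB _] := @spread_Sigma0 R _ _ SA.
  exists (spread (~` A)); split; last by split=> // /SE.
  apply: spread_immeasurable.
    by apply/set0P/eqP => A0; apply: nPA; rewrite /Pi0 /= A0; exact: S0.
  rewrite -[spread _]setCK Borel_measurableE; apply: measurableC.
  by rewrite -Borel_measurableE; exact: Sigma0_Borel PB.
Qed.
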